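(* Let $q\in\mathbb{N}$ with $q\ge 3$ and let $\mathcal{A}\subseteq\{0,1,\ldots,q-1\}$ with $1<\#\mathcal{A}<q$. Let $p_1,\ldots,p_\ell\in\mathbb{N}_{\ge 2}$ with $\gcd(q,p_1p_2\cdots p_\ell)=1$. Then for every positive rational $\alpha$, the set $\{(k_1,\ldots,k_\ell)\in\mathbb{N}_0^\ell: \alpha/(p_1^{k_1}\cdots p_\ell^{k_\ell})\in K(q,\mathcal{A})\}$ is finite.
   Context: $\mathbb{N}_0=\mathbb{N}\cup\{0\}$, $\mathbb{N}_{\ge n}=\{k\in\mathbb{N}:k\ge n\}$. $K(q,\mathcal{A}):=\{\sum_{i=1}^\infty d_i q^{-i}: d_i\in\mathcal{A}\ \forall i\in\mathbb{N}\}$. *)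

(* Defs.v *)
From HB Require Import structures.
From mathcomp Require Import all_boot all_order all_algebra.
From mathcomp Require Import all_classical all_reals all_analysis.

Set Implicit Arguments.
Unset Strict Implicit.
Unset Printing Implicit Defensive.

Import Order.TTheory GRing.Theory Num.Theory.
Import numFieldNormedType.Exports.

Local Open Scope classical_set_scope.
Local Open Scope ring_scope.

(* The digit sequence [d] is indexed from 0, so [d i] is the digit d_{i+1} of
   weight q^{-(i+1)}. *)
Definition missing_digit_set (R : realType) (q : nat) (A : {set 'I_q}) :
    set R :=
  [set x : R | exists d : nat -> 'I_q,
    (forall i, d i \in A) /\
    series (fun i => (d i)%:R / q%:R ^+ i.+1 : R) @ \oo --> x].

(* Main.v *)
(* After multiplying by a power of q we may write x = a / N, where N divides a
   power of a fixed Q coprime to q. Choose r with Q | M := q^r - 1 and M odd or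
   divisible by 4. Then the powers of q^r = 1 + M run through all residues
   1 + M t modulo M^K, by Hensel lifting in K, so the orbit of x under
   multiplication by q modulo 1 contains a (1 + M t) / N for every t. As a and M
   do not depend on N, for large N this progression of step a M / N enters the
   open interval (d / q, (d + 1) / q) of a missing digit d, which is impossible
   for x in K(q, A). Hence N is bounded. *)
Require Import Defs.
From HB Require Import structures.
From mathcomp Require Import all_boot all_order all_algebra.
From mathcomp Require Import all_classical all_reals all_analysis.
From mathcomp Require Import cyclic zify ring.

Set Implicit Arguments.
Unset Strict Implicit.
Unset Printing Implicit Defensive.

Import Order.TTheory GRing.Theory Num.Theory.
Import numFieldNormedType.Exports.

Local Open Scope classical_set_scope.
Local Open Scope ring_scope.

(** * Orbits under multiplication by q, via powers of 1 + M *)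

Section PowersModulo.
Local Open Scope nat_scope.

(** The order of truncation suits [X = M ^ k.+1 * u]: the cubic term is then a multiple of
    [M ^ k.+3], whereas the quadratic one needs care when [k = 0]. *)
Lemma expn_1D_trunc3 (X n : nat) :
  exists v, (1 + X) ^ n = 1 + n * X + 'C(n, 2) * X ^ 2 + X ^ 3 * v.
Proof.
elim: n => [|n [v IHn]]; first by exists 0; rewrite expn0 bin_small //; ring.
exists ('C(n, 2) + v * (1 + X)).
rewrite expnS IHn binS bin1; ring.
Qed.

(** Since [2 * 'C(M, 2) = M * M.-1], only [s = 2] is delicate: there [M] is even, so the parity
    hypothesis gives [4 %| M]. *)
Lemma prime_dvd_bin2 (M s : nat) :
  odd M || (4 %| M) -> prime s -> s %| M -> s %| 'C(M, 2).
Proof.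
move=> hM sp sM.
have E : 2 * 'C(M, 2) = M * M.-1.
  by rewrite bin2 mul2n even_halfK // oddM; case: (M) => //= n; rewrite andNb.
case: (eqVneq s 2) => [s2|sn2].
  have M4 : 4 %| M by case/orP: hM => // oM; move: sM; rewrite s2 dvdn2 oM.
  have : 2 * 2 %| 2 * 'C(M, 2) by rewrite E dvdn_mulr.
  by rewrite dvdn_pmul2l // s2.
have : s %| 2 * 'C(M, 2) by rewrite E dvdn_mulr.
rewrite Gauss_dvdr // prime_coprime //; apply: contra sn2 => s2.
by rewrite -dvdn_prime2.
Qed.

(* False for [M = 2 %[mod 4]] and [k > 0]: then ['C(M, 2)] is odd, so already
   [(1 + M) ^ M - 1] is divisible by [2 * M ^ 2]. *)
Lemma expn_1D_tower (M k : nat) : 0 < M -> odd M || (4 %| M) ->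
  exists2 u, coprime u M & (1 + M) ^ (M ^ k) = 1 + M ^ k.+1 * u.
Proof.
move=> M0 hM; elim: k => [|k [u cu IHk]].
  by exists 1; rewrite ?coprime1n // expn0 !expn1 muln1.
have [v Ev] := expn_1D_trunc3 (M ^ k.+1 * u) M.
(* This is the expansion at [X = M ^ k.+1 * u], less 1, divided by [M ^ k.+2]. Primes dividing [M]
   divide its last two terms, so it inherits coprimality to [M] from [u]. *)
exists (u + 'C(M, 2) * M ^ k * u ^ 2 + M ^ (k + k).+1 * u ^ 3 * v).
  rewrite /coprime; apply/negPn/negP => hg.
  set w := u + _ + _ in hg.
  have g1 : 1 < gcdn w M by have := gcdn_gt0 w M; lia.
  have sp := pdiv_prime g1; set s := pdiv _ in sp.
  have := pdiv_dvd (gcdn w M); rewrite -/s dvdn_gcd => /andP[sw sM].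
  have : s %| u.
    move: sw; rewrite /w -addnA dvdn_addl //.
    apply: dvdn_add; first by do 2 apply: dvdn_mulr; apply: prime_dvd_bin2.
    by do 2 apply: dvdn_mulr; rewrite expnS dvdn_mulr.
  move=> su; have : s %| gcdn u M by rewrite dvdn_gcd su.
  by rewrite (eqP cu) dvdn1 => /eqP s1; rewrite s1 in sp.
rewrite expnSr expnM IHk Ev !expnMn !expnS addnC expnD; ring.
Qed.

Lemma coprime_mul_modn_surj (w M s : nat) : 0 < M -> coprime w M ->
  exists i, w * i = s %[mod M].
Proof.
move=> M0 cw; case: (posnP w) => [w0|w0].
  move: cw; rewrite w0 /coprime gcd0n => /eqP->.
  by exists 0; rewrite !modn1.
case: (egcdnP M w0) => i j E _; exists (i * s).
by rewrite mulnA [w * i]mulnC E (eqP cw) mulnDl mul1n mulnAC modnMDl.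
Qed.

(** Hensel step: if [g = (1 + M) ^ j] is right modulo [P = M ^ k.+1], multiplying it by
    [(1 + M) ^ (M ^ k * i) = (1 + P * u) ^ i] adds [P * (g * u * i)] modulo [P * M]. As [g * u] is
    invertible modulo [M], some [i] gives the required correction. *)
Lemma powers_1D_modn_surj (M k t : nat) : 0 < M -> odd M || (4 %| M) ->
  exists j, (1 + M) ^ j = 1 + M * t %[mod M ^ k.+1].
Proof.
move=> M0 hM; elim: k => [|k [j IHk]].
  by exists 0; rewrite expn0 expn1 mulnC addnC modnMDl.
have [u cu Eu] := expn_1D_tower k M0 hM.
set P := M ^ k.+1 in IHk Eu.
set g := (1 + M) ^ j in IHk.
have cg : coprime (g * u) M.
  by rewrite coprimeMl cu andbT coprimeXl // add1n coprimeSn.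
(* Modulo [M] this is the difference of the two quotients by [P]; the factor [M.-1] stands for -1
   and avoids truncated subtraction. *)
set s := (1 + M * t) %/ P + (g %/ P) * M.-1.
have Es : g + P * s = 1 + M * t + P * M * (g %/ P).
  rewrite [X in X + _ = _](divn_eq g P) IHk.
  rewrite [in RHS](divn_eq (1 + M * t) P) /s.
  by case: (M) M0 => // M' _ /=; ring.
have [i Ei] := coprime_mul_modn_surj s M0 cg.
exists (j + M ^ k * i).
have [v Ev] := expn_1D_trunc3 (P * u) i.
have PS : M ^ k.+2 = P * M by rewrite expnSr.
have PM : P = M * M ^ k by rewrite /P expnS.
rewrite expnD expnM Eu Ev -/g PS.
have -> : g * (1 + i * (P * u) + 'C(i, 2) * (P * u) ^ 2 + (P * u) ^ 3 * v) =
  (g * 'C(i, 2) * M ^ k * u ^ 2 + g * M ^ k * P * u ^ 3 * v) * (P * M) +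
  (g + P * (g * u * i)).
  by rewrite PM; ring.
rewrite modnMDl -modnDmr -muln_modr Ei muln_modr modnDmr Es.
by rewrite addnC mulnC modnMDl.
Qed.


(** Take twice Euler's exponent: with [h = q ^ totient Q], [Q] divides [h - 1], and
    [(h - 1) * (h + 1)] is odd for even [h] and a product of two even numbers for odd [h]. *)
Lemma exists_pow_sub1_dvdn (q Q : nat) : 1 < q -> 0 < Q -> coprime q Q ->
  exists r, let M := q ^ r - 1 in
  [/\ 0 < M, odd M || (4 %| M) & Q %| M].
Proof.
move=> q1 Q0 cqQ; set f := totient Q.
have f0 : 0 < f by rewrite totient_gt0.
have h1 : 1 < q ^ f by rewrite -(expn0 q) ltn_exp2l.
exists (f * 2); rewrite /= expnM; set h := q ^ f in h1 *.
have E : h ^ 2 - 1 = (h - 1) * (h + 1) by have := subn_sqr h 1; rewrite exp1n.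
split; first by rewrite E muln_gt0 subn_gt0 h1 addn1.
  rewrite E; have [oh|oh] := boolP (odd h); last first.
    by rewrite oddM oddB ?oddD ?(ltnW h1) // (negbTE oh).
  by rewrite orbC (@dvdn_mul 2 2) // dvdn2 ?oddB ?oddD ?(ltnW h1) // oh.
rewrite E dvdn_mulr // -eqn_mod_dvd ?(ltnW h1) //.
exact/eqP/Euler_exp_totient.
Qed.

(* The multiples [a * (1 + M * t)] advance in steps of [a * M], which is less
   than the length [N / q] of the gap once [N] is large. *)
Lemma progression_hits_gap (q a M d N : nat) : 0 < q -> 0 < a -> 0 < M ->
  q * (a * M) < N -> exists t, d * N < q * (a * (1 + M * t)) < d.+1 * N.
Proof.
move=> q0 a0 M0 hN.
have ex : exists t, d * N < q * (a * (1 + M * t)).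
  exists (d * N); apply: (@leq_trans (1 + M * (d * N))).
    by rewrite add1n ltnS leq_pmull.
  by rewrite [q * (a * _)]mulnA leq_pmull // muln_gt0 q0.
(* At the least such index the previous term is at most [d * N]; at index 0 the term [q * a] is
   below [N] anyway. *)
case: (ex_minnP ex) => -[|t] ht tmin; [exists 0 | exists t.+1];
  rewrite ht /= mulSn.
  have : q * (a * 1) <= q * (a * M) by rewrite !leq_mul.
  by rewrite muln0 addn0; lia.
have : q * (a * (1 + M * t)) <= d * N.
  by rewrite leqNgt; apply/negP => /tmin; rewrite ltnn.
rewrite mulnS addnCA !mulnDr; lia.
Qed.

(** The bound [B = q * (a * M)] is fixed before [N] and [K]. Residues modulo [M ^ K.+1] determine
    those modulo [N], since [N %| Q ^ K] and [Q %| M]. *)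
Lemma orbit_hits_gap (q Q a d : nat) :
  1 < q -> 0 < a -> 0 < Q -> coprime q Q -> d < q ->
  exists B, forall N K, B < N -> N %| Q ^ K ->
    exists j w c, q ^ j * a = w * N + c /\ d * N < q * c < d.+1 * N.
Proof.
move=> q1 a0 Q0 cqQ dq.
have [r /= [M0 hM QM]] := exists_pow_sub1_dvdn q1 Q0 cqQ.
set M := _ - 1 in M0 hM QM; exists (q * (a * M)) => N K BN NQ.
have [t ht] := progression_hits_gap d (ltnW q1) a0 M0 BN.
have [j Ej] := powers_1D_modn_surj K t M0 hM.
have N0 : 0 < N by apply: leq_ltn_trans BN.
have NM : N %| M ^ K.+1.
  apply: dvdn_trans NQ _; apply: dvdn_trans (dvdn_exp2r K QM) _.
  by rewrite expnS dvdn_mull.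
have qr : q ^ r = 1 + M by rewrite /M subnKC // expn_gt0 (ltnW q1).
set c := a * (1 + M * t) in ht.
(* The gap lies in the unit interval because [d < q], so [c] is a genuine remainder modulo [N]. *)
have cN : c < N.
  case/andP: ht => _ h; rewrite -(ltn_pmul2l (ltnW q1)).
  by apply: leq_trans h _; rewrite leq_mul2r dq orbT.
exists (r * j), (q ^ (r * j) * a %/ N), c; split=> //.
rewrite {1}(divn_eq (q ^ (r * j) * a) N); congr (_ + _).
rewrite expnM qr -modnMml -(modn_dvdm ((1 + M) ^ j) NM) Ej.
by rewrite (modn_dvdm _ NM) modnMml mulnC modn_small.
Qed.

(** The equation reads q^m / b = c / b': a power of q clears the primes shared with q from the
    denominator. The induction divides [b] by [gcdn q b]. *)
Lemma coprime_part (q b : nat) : 0 < q -> 0 < b ->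
  exists m b' c, [/\ 0 < b', 0 < c, coprime q b' & q ^ m * b' = c * b].
Proof.
move=> q0; have [n] := ubnP b; elim: n b => // n IHn b; rewrite ltnS => bn b0.
have [g1|g1] := eqVneq (gcdn q b) 1.
  by exists 0, b, 1; split=> //; apply/eqP.
set g := gcdn q b in g1.
have gg : 1 < g by have := gcdn_gt0 q b; rewrite q0 -/g; lia.
have [q' Eq] : exists q', q = q' * g by apply/dvdnP; apply: dvdn_gcdl.
have [b1 Eb] : exists b1, b = b1 * g by apply/dvdnP; apply: dvdn_gcdr.
have b10 : 0 < b1 by move: b0; rewrite Eb; case: (b1).
have q'0 : 0 < q' by move: q0; rewrite Eq; case: (q').
have [|m [b' [c [b'0 c0 cb' E]]]] := IHn b1 _ b10.
  by apply: leq_trans bn; rewrite Eb ltn_Pmulr.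
exists m.+1, b', (c * q'); split=> //; first by rewrite muln_gt0 c0.
by rewrite expnS -mulnA E Eb [in LHS]Eq; ring.
Qed.

End PowersModulo.

(** * Truncations of a base q expansion *)

Section Digits.
Variables (R : realType) (q : nat) (d : nat -> 'I_q).

Let S : nat -> R := series (fun i => (d i)%:R / q%:R ^+ i.+1).

Let q_gt0 : 0 < q%:R :> R.
Proof. by rewrite ltr0n; apply: leq_ltn_trans (ltn_ord (d 0)). Qed.

Let qn_gt0 n : 0 < q%:R ^+ n :> R.
Proof. exact: exprn_gt0. Qed.

Let seriesS n : S n.+1 = S n + (d n)%:R / q%:R ^+ n.+1.
Proof. by rewrite /S /series /= big_nat_recr. Qed.

Lemma digit_series_nat n : exists w : nat, q%:R ^+ n * S n = w%:R.
Proof.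
elim: n => [|n [w IHn]].
  by exists 0%N; rewrite /S /series /= big_geq // mulr0.
exists (q * w + d n)%N.
rewrite seriesS mulrDr exprS -mulrA IHn natrD natrM mulrCA divff ?mulr1 //.
by rewrite -exprS lt0r_neq0.
Qed.

Lemma digit_series_le n m : (n <= m)%N -> S n <= S m.
Proof.
move=> /subnKC <-; elim: (m - n)%N => [|k IHk]; first by rewrite addn0.
rewrite addnS seriesS; apply: le_trans IHk _.
by rewrite lerDl divr_ge0 // ltW.
Qed.

(** One step is [d n + 1 <= q] divided by q^(n+1). The decreasing sequence bounds the limit from
    above. *)
Lemma digit_series_tail n m : (n <= m)%N ->
  S m + (q%:R ^+ m)^-1 <= S n + (q%:R ^+ n)^-1.
Proof.
move=> /subnKC <-; elim: (m - n)%N => [|k]; first by rewrite addn0.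
apply: le_trans; rewrite addnS seriesS -addrA lerD2l.
rewrite -[X in _ + X <= _]mul1r -mulrDl ler_pdivrMr // exprS mulrCA mulVf.
  by rewrite mulr1 natr1 ler_nat.
by rewrite lt0r_neq0.
Qed.

(** Both bounds must be weak: expansions ending in digits 0 or q - 1 attain them. *)
Lemma digit_expansion_prefix (x : R) (m : nat) : S @ \oo --> x ->
  exists n : nat,
    (n * q + d m)%:R <= q%:R ^+ m.+1 * x <= (n * q + d m).+1%:R.
Proof.
move=> cvgx; have [n En] := digit_series_nat m; exists n.
have E : q%:R ^+ m.+1 * S m.+1 = (n * q + d m)%:R.
  rewrite seriesS mulrDr exprS -mulrA En natrD natrM mulrCA divff.
    by rewrite mulr1 mulrC.
  by rewrite -exprS lt0r_neq0.
rewrite -natr1 -{}E -[X in _ + X](@mulfV _ (q%:R ^+ m.+1)) ?lt0r_neq0 //.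
rewrite -mulrDr !ler_pM2l //; apply/andP; split.
  apply: (cvgr_to_ge cvgx); near=> k; apply: digit_series_le.
  by near: k; exact: nbhs_infty_ge.
apply: (cvgr_to_le cvgx); near=> k.
apply: (@le_trans _ _ (S k + (q%:R ^+ k)^-1)).
  by rewrite lerDl invr_ge0 ltW.
by apply: digit_series_tail; near: k; exact: nbhs_infty_ge.
Unshelve. all: by end_near. Qed.

End Digits.

(** After division by [N], one point lies in the open interval (u, u + 1) and in the closed interval
    [v, v + 1] with u and v integers, which forces u = v. *)
Lemma eq_of_sandwich (n e w d c q N : nat) :
  (d * N < q * c < d.+1 * N ->
   (n * q + e) * N <= q * (w * N + c) <= (n * q + e).+1 * N ->
   (n * q + e) = w * q + d)%N.
Proof.
move=> /andP[c1 c2] /andP[h1 h2].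
have E : (q * (w * N + c) = w * q * N + q * c)%N by ring.
have : (n * q + e < (w * q + d).+1)%N.
  have : ((n * q + e) * N < (w * q + d).+1 * N)%N.
    apply: leq_ltn_trans h1 _.
    by rewrite E -[(w * q + d).+1]addnS mulnDl ltn_add2l.
  by rewrite ltn_mul2r => /andP[].
have : (w * q + d < (n * q + e).+1)%N.
  have : ((w * q + d) * N < (n * q + e).+1 * N)%N.
    by apply: leq_trans h2; rewrite E mulnDl ltn_add2l.
  by rewrite ltn_mul2r => /andP[].
lia.
Qed.

(** * Finiteness of the set of exponents *)

Lemma finite_bounded_ffun (l B : nat) :
  finite_set [set k : {ffun 'I_l -> nat} | forall i, (k i <= B)%N].
Proof.
apply: (@sub_finite_set _ _
  (range (fun g : {ffun 'I_l -> 'I_B.+1} => [ffun i => g i : nat]))).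
  move=> k hk; exists [ffun i => inord (k i)] => //.
  by apply/ffunP => i; rewrite !ffunE inordK // ltnS; apply: hk.
exact/finite_image/finite_finset.
Qed.

Theorem theorem2p1 (R : realType) (q : nat) (hq : (3 <= q)%N)
    (A : {set 'I_q}) (hA : (1 < #|A| < q)%N)
    (l : nat) (p : 'I_l -> nat) (hp : forall i : 'I_l, (2 <= p i)%N)
    (hqp : gcdn q (\prod_(i < l) p i)%N = 1%N)
    (alpha : rat) (halpha : 0 < alpha) :
  finite_set [set k : {ffun 'I_l -> nat} |
    missing_digit_set A
      (ratr alpha / (\prod_(i < l) p i ^ k i)%N%:R : R)].
Proof.
have q1 : (1 < q)%N by apply: ltn_trans hq.
have q0 : (0 < q)%N by apply: ltnW.
have [d dA] : exists d, d \notin A.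
  apply/existsP; rewrite -negb_forall; apply/negP => /forallP AT.
  case/andP: hA => _; rewrite -[X in (_ < X)%N]card_ord ltnNge => /negP; apply.
  by apply: subset_leq_card; apply/fintype.subsetP => i _.
set a := `|numq alpha|%N; set b := `|denq alpha|%N.
have a0 : (0 < a)%N by rewrite absz_gt0 gt_eqF // numq_gt0.
have b0 : (0 < b)%N by rewrite absz_gt0 gt_eqF // denq_gt0.
have Ealpha : ratr alpha = a%:R / b%:R :> R.
  by rewrite /ratr /a /b !natr_absz !ger0_norm // ?ltW ?denq_gt0 ?numq_gt0 //.
(* Now q^m alpha = a c / b', so q^m times the point is a c / N with [N = b' * P]. *)
have [m [b' [c [b'0 c0 cqb' Ebb']]]] := coprime_part q0 b0.
set Q := (b' * \prod_(i < l) p i)%N.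
have p0 : (0 < \prod_(i < l) p i)%N.
  by apply: prodn_gt0 => i; apply: ltnW.
have Q0 : (0 < Q)%N by rewrite muln_gt0 b'0.
have cqQ : coprime q Q by rewrite coprimeMr cqb' /coprime hqp.
have ac0 : (0 < a * c)%N by rewrite muln_gt0 a0.
have [B hB] := orbit_hits_gap q1 ac0 Q0 cqQ (ltn_ord d).
apply: (sub_finite_set _ (finite_bounded_ffun l B)) => k [e [eA cvge]] i.
set P := (\prod_(i < l) p i ^ k i)%N in cvge.
have pk0 j : (0 < p j ^ k j)%N by rewrite expn_gt0 ltnW.
have P0 : (0 < P)%N by apply: prodn_gt0.
(* Bounding [N] bounds each exponent, as [k i < p i ^ k i <= P]. *)
suff PB : (b' * P <= B)%N.
  apply: leq_trans PB; apply: (@leq_trans P); last exact: leq_pmull.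
  apply: leq_trans (ltnW (ltn_expl (k i) (hp i))) _.
  by apply: dvdn_leq => //; rewrite /P (bigD1 i) //= dvdn_mulr.
rewrite leqNgt; apply/negP => BN; set N := (b' * P)%N in BN.
have N0 : (0 < N)%N by rewrite muln_gt0 b'0.
(* One factor [Q] absorbs [b']; the product of the [p i] to the power [k i] absorbs [p i ^ k i]. *)
have NQ : (N %| Q ^ (\sum_(i < l) k i).+1)%N.
  rewrite expnMn !expnS; apply: dvdn_mul; first exact: dvdn_mulr.
  rewrite dvdn_mull // expn_sum.
  apply: (big_ind2 (fun x y => x %| y)%N) => //.
    by move=> *; apply: dvdn_mul.
  by move=> j _; apply: dvdn_exp2r; rewrite (bigD1 j) //= dvdn_mulr.
have [j [w [c' [Ej hc']]]] := hB _ _ BN NQ.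
have [n hn] := digit_expansion_prefix (m + j) cvge.
have Ex : q%:R ^+ (m + j).+1 * (ratr alpha / P%:R) * N%:R =
    (q * (w * N + c'))%:R :> R.
  have bR : b%:R != 0 :> R by rewrite pnatr_eq0 -lt0n.
  have PR : P%:R != 0 :> R by rewrite pnatr_eq0 -lt0n.
  have Ebb : q%:R ^+ m * b'%:R = c%:R * b%:R :> R.
    by rewrite -natrX -!natrM Ebb'.
  rewrite -Ej /N !natrM natrX Ealpha exprS exprD.
  rewrite [LHS](_ : _ = q%:R * (q%:R ^+ j * (a%:R / b%:R *
    (q%:R ^+ m * b'%:R)))); first by rewrite Ebb; field.
  by field; rewrite bR PR.
have hnN : ((n * q + e (m + j)) * N <= q * (w * N + c')
            <= (n * q + e (m + j)).+1 * N)%N.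
  by rewrite -!(ler_nat R) -Ex ![(_ * N)%:R]natrM !ler_pM2r ?ltr0n //.
(* Reduction modulo [q] identifies the digit [e (m + j)] with the missing digit [d]. *)
have := eq_of_sandwich hc' hnN.
move=> /(congr1 (modn^~ q)); rewrite !modnMDl !modn_small // => /val_inj ed.
by move: dA; rewrite -ed eA.
Qed.
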